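(* Let $\nu,\mu\in\mathbb R$, let $\lambda$ be a constant and $\lambda^{*}_{\nu-\mu}=\lambda-\kappa_{2\nu-2\mu-1}$. Let $a,b$ be complex numbers with the same imaginary part and $b-a\in\mathbb N$, let $C$ be a contour in the complex $s$-plane, and assume: (i) functions $\rho(z)$ and $\rho_\nu(z)$ satisfy $\frac{\Delta(\sigma(z)\rho(z))}{\nabla x_1(z)}=\tau(z)\rho(z)$ and $\frac{\Delta(\sigma(z)\rho_\nu(z))}{\nabla x_{\nu+1}(z)}=\tau_\nu(z)\rho_\nu(z)$; (ii) $\mu,\nu$ satisfy $\lambda^{*}_{\nu-\mu}+\kappa_{2\nu-(\mu+1)}\gamma(\mu+1)=0$; (iii) with the functions $$\phi_{\nu m}(z)=\sum_{s=a}^{b-1}\frac{\rho_\nu(s)\nabla x_{\nu+1}(s)}{[x_\nu(s)-x_\nu(z)]^{(m+1)}}\quad\text{or}\quad \phi_{\nu m}(z)=\oint_C\frac{\rho_\nu(s)\nabla x_{\nu+1}(s)\,ds}{[x_\nu(s)-x_\nu(z)]^{(m+1)}},$$ the difference derivative of $\phi_{\nu\mu}$ (that is, $m=\mu$) can be carried out by means of the formula $\frac{\nabla\phi_{\nu\mu}(z)}{\nabla x_{\nu-\mu}(z)}=\gamma(\mu+1)\phi_{\nu,\mu+1}(z)$; (iv) the following equalities hold: $$\psi_{\nu\mu}(a,z)=\psi_{\nu\mu}(b,z),\qquad \oint_C\Delta_s\psi_{\nu\mu}(s,z)\,ds=0,$$ where $\psi_{\nu\mu}(s,z)=\frac{\sigma(s)\rho_\nu(s)}{[x_{\nu-1}(s)-x_{\nu-1}(z+1)]^{(\mu+1)}}$.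 Let $\rho_{\nu-\mu}(z)$ satisfy the Pearson type equation $\frac{\Delta(\sigma(z)\rho_{\nu-\mu}(z))}{\Delta x_{\nu-\mu-1}(z)}=\tau_{\nu-\mu}(z)\rho_{\nu-\mu}(z)$, and let $\nu,\mu$ be roots of the equation $\lambda+\kappa_{2\nu-\mu}\gamma(\mu)=0$. Then the equation $$\sigma(z)\frac{\Delta}{\Delta x_{\nu-\mu-1}(z)}\Big(\frac{\nabla y(z)}{\nabla x_{\nu-\mu}(z)}\Big)+\tau_{\nu-\mu}(z)\frac{\Delta y(z)}{\Delta x_{\nu-\mu}(z)}+\lambda y(z)=0$$ has particular solutions in the form of $$y(z)=\frac1{\rho_{\nu-\mu}(z)}\sum_{s=a}^{b-1}\frac{\rho_\nu(s)\nabla x_{\nu+1}(s)}{[x_\nu(s)-x_\nu(z)]^{(\mu+1)}}$$ and also in the form of $$y(z)=\frac1{\rho_{\nu-\mu}(z)}\oint_C\frac{\rho_\nu(s)\nabla x_{\nu+1}(s)\,ds}{[x_\nu(s)-x_\nu(z)]^{(\mu+1)}}.$$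
   Context: Lattice and differences. $x(s)$, $s\in\mathbb C$, is a non-uniform lattice: either $x(s)=c_1q^s+c_2q^{-s}+c_3$ with $c_1c_2\ne0$ ($q\ne0,1$ fixed, with a fixed branch of $q^s$), or $x(s)=\tilde c_1s^2+\tilde c_2s+\tilde c_3$ with $\tilde c_1\tilde c_2\neq0$. For real $\eta$, $x_\eta(s)=x(s+\frac{\eta}{2})$. $\Delta f(s)=f(s+1)-f(s)$, $\nabla f(s)=f(s)-f(s-1)$; $\Delta_s$ means the difference is taken in $s$. Expressions are considered where denominators do not vanish. Sums $\sum_{s=a}^{b-1}$ run over $s=a,a+1,\dots,b-1$. Coefficients. $\tilde\sigma[x]$ and $\tilde\tau[x]$ are polynomials in $x$ of degrees at most two and one; $\tau(z)=\tilde\tau[x(z)]$ and $\sigma(z)=\tilde\sigma[x(z)]-\frac12\tilde\tau[x(z)]\nabla x_1(z)$. For real $\eta$, $\tau_\eta$ is defined by $\tau_\eta(z)\nabla x_{\eta+1}(z)=\sigma(z+\eta)-\sigma(z)+\tau(z+\eta)\nabla x_1(z+\eta)$. Put $\gamma(\eta)=\frac{q^{\eta/2}-q^{-\eta/2}}{q^{1/2}-q^{-1/2}}$ for the first kind of lattice and $\gamma(\eta)=\eta$ for the second, and $\kappa_\eta=\tilde\tau'+\frac12(\eta-1)\tilde\sigma''$ (derivatives with respect to $x$). Generalized powers. $[x_\eta(s)-x_\eta(z)]^{(m)}$ ($\eta,m$ real) denotes Suslov's generalized power: a fixed family of functions of $(s,z)$ with $[x_\eta(s)-x_\eta(z)]^{(0)}=1$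 and, for all real $\eta,m$, $$[x_\eta(s)-x_\eta(z)]\,[x_\eta(s)-x_\eta(z-1)]^{(m)}=[x_\eta(s)-x_\eta(z)]^{(m)}\,[x_\eta(s)-x_\eta(z-m)]=[x_\eta(s)-x_\eta(z)]^{(m+1)},$$ $$[x_{\eta-1}(s+1)-x_{\eta-1}(z)]^{(m)}[x_{\eta-m}(s)-x_{\eta-m}(z)]=[x_{\eta-m}(s+m)-x_{\eta-m}(z)][x_{\eta-1}(s)-x_{\eta-1}(z)]^{(m)}=[x_\eta(s)-x_\eta(z)]^{(m+1)}.$$ For a nonnegative integer $m$ it equals $\prod_{j=0}^{m-1}[x_\eta(s)-x_\eta(z-j)]$.
   Formalization: On the q-lattice, κ_η is corrected to α(η−1)τ̃' + ½γ(η−1)σ̃'' with α(η) = (q^{η/2}+q^{−η/2})/2, since with the printed κ_η the claim fails there; on the quadratic lattice κ_η is unchanged. *)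

(* Defs.v *)
From Stdlib Require Export Reals List.
From Coquelicot Require Export Coquelicot.
Open Scope C_scope.

Definition Delta (f : C -> C) (s : C) : C := f (s + 1) - f s.
Definition nabla (f : C -> C) (s : C) : C := f s - f (s - 1).

Definition Cexp (z : C) : C :=
  (exp (Re z) * cos (Im z), exp (Re z) * sin (Im z))%R.

(** [QLattice q ell c1 c2 c3] is c1 q^s + c2 q^(-s) + c3, where [ell] is the
    value of log q that fixes the branch: q^s = exp (ell * s). *)
Inductive lattice : Type :=
| QLattice (q ell c1 c2 c3 : C)
| QuadLattice (c1 c2 c3 : C).

Definition lattice_wf (X : lattice) : Prop :=
  match X with
  | QLattice q ell c1 c2 _ =>
      q <> 0 /\ q <> 1 /\ Cexp ell = q /\ c1 * c2 <> 0
  | QuadLattice c1 c2 _ => c1 * c2 <> 0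
  end.

Definition qpow (ell s : C) : C := Cexp (ell * s).

Definition xlat (X : lattice) (s : C) : C :=
  match X with
  | QLattice _ ell c1 c2 c3 => c1 * qpow ell s + c2 * qpow ell (- s) + c3
  | QuadLattice c1 c2 c3 => c1 * (s * s) + c2 * s + c3
  end.

Definition xs (X : lattice) (eta : R) (s : C) : C := xlat X (s + RtoC (eta / 2)).

Definition gam (X : lattice) (eta : R) : C :=
  match X with
  | QLattice _ ell _ _ _ =>
      (qpow ell (RtoC (eta / 2)) - qpow ell (RtoC (- (eta / 2))))
      / (qpow ell (RtoC (1 / 2)) - qpow ell (RtoC (- (1 / 2))))
  | QuadLattice _ _ _ => RtoC eta
  end.

Definition alph (X : lattice) (eta : R) : C :=
  match X with
  | QLattice _ ell _ _ _ =>
      (qpow ell (RtoC (eta / 2)) + qpow ell (RtoC (- (eta / 2)))) / 2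
  | QuadLattice _ _ _ => 1
  end.

(** sigma~ = sg2 x^2 + sg1 x + sg0 and tau~ = ta1 x + ta0. *)
Record coeffs : Type := Coeffs { sg2 : C; sg1 : C; sg0 : C; ta1 : C; ta0 : C }.

Definition sigma_t (co : coeffs) (x : C) : C := sg2 co * (x * x) + sg1 co * x + sg0 co.
Definition tau_t (co : coeffs) (x : C) : C := ta1 co * x + ta0 co.
Definition dtau_t (co : coeffs) : C := ta1 co.
Definition d2sigma_t (co : coeffs) : C := 2 * sg2 co.

(** On the quadratic lattice this is tau~' + (eta - 1) sigma~'' / 2, since there
    alph = 1 and gam eta = eta.  On the q-lattice the plain formula
    tau~' + (eta - 1) sigma~'' / 2 would not give the coefficient of x_nu in
    tau_nu; the Nikiforov-Suslov-Uvarov coefficient below does. *)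
Definition kappa (X : lattice) (co : coeffs) (eta : R) : C :=
  alph X (eta - 1) * dtau_t co + RtoC (1 / 2) * gam X (eta - 1) * d2sigma_t co.

Definition tau (X : lattice) (co : coeffs) (z : C) : C := tau_t co (xlat X z).

Definition sigma (X : lattice) (co : coeffs) (z : C) : C :=
  sigma_t co (xlat X z) - RtoC (1 / 2) * tau_t co (xlat X z) * nabla (xs X 1) z.

(** Meaningful only where the denominator is nonzero. *)
Definition taus (X : lattice) (co : coeffs) (eta : R) (z : C) : C :=
  (sigma X co (z + RtoC eta) - sigma X co z
   + tau X co (z + RtoC eta) * nabla (xs X 1) (z + RtoC eta))
  / nabla (xs X (eta + 1)) z.

(** Functions that need not be defined everywhere (e.g. quotients of Gamma
    functions, which have poles). *)
Record pfun : Type := PFun { pdom : C -> Prop; pval :> C -> C }.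

Definition cprod (f : nat -> C) (n : nat) : C :=
  fold_right Cmult 1 (map f (seq 0 n)).

(** [gp P eta m s z] is [x_eta(s) - x_eta(z)]^(m).  A domain is needed: the
    powers have poles, and for instance the first recursion with m = -1 and
    s = z would read 0 = 1 if every power were required to be finite. *)
Record gen_power (X : lattice) : Type := GenPower {
  gp_dom : R -> R -> C -> C -> Prop;
  gp :> R -> R -> C -> C -> C;
  gp_nat : forall (eta : R) (n : nat) (s z : C),
    gp_dom eta (INR n) s z /\
    gp eta (INR n) s z = cprod (fun j => xs X eta s - xs X eta (z - RtoC (INR j))) n;
  gp_rec : forall (eta m : R) (s z : C),
    gp_dom eta m s (z - 1) -> gp_dom eta m s z -> gp_dom eta (m + 1) s z ->
    (xs X eta s - xs X eta z) * gp eta m s (z - 1)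
      = gp eta m s z * (xs X eta s - xs X eta (z - RtoC m)) /\
    gp eta m s z * (xs X eta s - xs X eta (z - RtoC m)) = gp eta (m + 1) s z;
  gp_shift : forall (eta m : R) (s z : C),
    gp_dom (eta - 1) m (s + 1) z -> gp_dom (eta - 1) m s z ->
    gp_dom eta (m + 1) s z ->
    gp (eta - 1)%R m (s + 1) z * (xs X (eta - m) s - xs X (eta - m) z)
      = (xs X (eta - m) (s + RtoC m) - xs X (eta - m) z) * gp (eta - 1)%R m s z /\
    (xs X (eta - m) (s + RtoC m) - xs X (eta - m) z) * gp (eta - 1)%R m s z
      = gp eta (m + 1) s z
}.
Arguments gp_dom {X} _ _ _ _ _.
Arguments gp {X} _ _ _ _ _.

(** Delta (sigma rho) / dx = t rho, at the points where it makes sense. *)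
Definition pearson (X : lattice) (co : coeffs) (dx t : C -> C) (rho : pfun) : Prop :=
  forall z : C, pdom rho z -> pdom rho (z + 1) -> dx z <> 0 ->
    Delta (fun w => sigma X co w * rho w) z / dx z = t z * rho z.

Definition phi_term (X : lattice) (P : gen_power X) (rho_nu : pfun)
    (nu m : R) (z s : C) : C :=
  rho_nu s * nabla (xs X (nu + 1)) s / P nu (m + 1)%R s z.

Definition phi_term_ok (X : lattice) (P : gen_power X) (rho_nu : pfun)
    (nu m : R) (z s : C) : Prop :=
  pdom rho_nu s /\ gp_dom P nu (m + 1) s z /\ P nu (m + 1)%R s z <> 0.

Definition psi (X : lattice) (co : coeffs) (P : gen_power X) (rho_nu : pfun)
    (nu mu : R) (s z : C) : C :=
  sigma X co s * rho_nu s / P (nu - 1)%R (mu + 1)%R s (z + 1).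

Definition psi_ok (X : lattice) (P : gen_power X) (rho_nu : pfun)
    (nu mu : R) (s z : C) : Prop :=
  pdom rho_nu s /\ gp_dom P (nu - 1) (mu + 1) s (z + 1) /\
  P (nu - 1)%R (mu + 1)%R s (z + 1) <> 0.

(** f(a) + f(a+1) + ... + f(a+N-1); this is the sum from a to b-1 if b - a = N. *)
Definition csum (f : C -> C) (a : C) (N : nat) : C :=
  fold_right Cplus 0 (map (fun j => f (a + RtoC (INR j))) (seq 0 N)).

Definition C1 (g : R -> C) : Prop :=
  forall t : R,
    ex_derive (fun u => Re (g u)) t /\ ex_derive (fun u => Im (g u)) t /\
    continuous (Derive (fun u => Re (g u))) t /\
    continuous (Derive (fun u => Im (g u))) t.

Inductive pw_C1 (c : R -> C) : R -> R -> Prop :=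
| pw_C1_arc (u v : R) (g : R -> C) :
    (u < v)%R -> C1 g -> (forall t, (u <= t <= v)%R -> c t = g t) -> pw_C1 c u v
| pw_C1_join (u v w : R) : pw_C1 c u v -> pw_C1 c v w -> pw_C1 c u w.

(** Piecewise continuously differentiable, closed or not. *)
Record contour : Type := Contour { path :> R -> C; path_pw : pw_C1 path 0 1 }.

Definition path_deriv (c : R -> C) (t : R) : C :=
  (Derive (fun u => Re (c u)) t, Derive (fun u => Im (c u)) t).

Definition is_cint (f : C -> C) (c : contour) (l : C) : Prop :=
  is_RInt (V := C_R_NormedModule) (fun t => f (c t) * path_deriv c t) 0 1 l.

Definition ex_cint (f : C -> C) (c : contour) : Prop := exists l : C, is_cint f c l.

Definition cint (f : C -> C) (c : contour) : C :=
  RInt (V := C_R_CompleteNormedModule) (fun t => f (c t) * path_deriv c t) 0 1.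

Definition phi_sum (X : lattice) (P : gen_power X) (rho_nu : pfun) (a : C) (N : nat)
    (nu m : R) (z : C) : C :=
  csum (phi_term X P rho_nu nu m z) a N.

Definition phi_sum_ok (X : lattice) (P : gen_power X) (rho_nu : pfun) (a : C) (N : nat)
    (nu m : R) (z : C) : Prop :=
  forall j : nat, (j < N)%nat -> phi_term_ok X P rho_nu nu m z (a + RtoC (INR j)).

Definition phi_int (X : lattice) (P : gen_power X) (rho_nu : pfun) (c : contour)
    (nu m : R) (z : C) : C :=
  cint (phi_term X P rho_nu nu m z) c.

Definition phi_int_ok (X : lattice) (P : gen_power X) (rho_nu : pfun) (c : contour)
    (nu m : R) (z : C) : Prop :=
  (forall t : R, (0 <= t <= 1)%R -> phi_term_ok X P rho_nu nu m z (c t)) /\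
  ex_cint (phi_term X P rho_nu nu m z) c.

Definition psi_sum_ok (X : lattice) (P : gen_power X) (rho_nu : pfun) (a : C) (N : nat)
    (nu mu : R) (z : C) : Prop :=
  forall j : nat, (j <= N)%nat -> psi_ok X P rho_nu nu mu (a + RtoC (INR j)) z.

(** Both psi(s, z) and psi(s+1, z) occur in Delta_s psi(s, z). *)
Definition psi_int_ok (X : lattice) (P : gen_power X) (rho_nu : pfun) (c : contour)
    (nu mu : R) (z : C) : Prop :=
  forall t : R, (0 <= t <= 1)%R ->
    psi_ok X P rho_nu nu mu (c t) z /\ psi_ok X P rho_nu nu mu (c t + 1) z.

(** [phi m z] stands for phi_{nu,m}(z), and [ok m z] says that it is well defined. *)
Definition phi_derivative (X : lattice) (nu mu : R)
    (phi : R -> C -> C) (ok : R -> C -> Prop) : Prop :=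
  forall z : C, ok mu z -> ok mu (z - 1) -> ok (mu + 1)%R z ->
    nabla (xs X (nu - mu)) z <> 0 ->
    nabla (phi mu) z / nabla (xs X (nu - mu)) z = gam X (mu + 1) * phi (mu + 1)%R z.

Definition hyper_eq (X : lattice) (co : coeffs) (k : R) (lam : C) (y : C -> C) (z : C) : Prop :=
  sigma X co z
    * (Delta (fun w => nabla y w / nabla (xs X k) w) z / Delta (xs X (k - 1)) z)
  + taus X co k z * (Delta y z / Delta (xs X k) z) + lam * y z = 0.

(** y(w) = phi(w) / rho_k(w) makes sense. *)
Definition y_ok (rho_k : pfun) (phi_ok : C -> Prop) (w : C) : Prop :=
  pdom rho_k w /\ rho_k w <> 0 /\ phi_ok w.

(** The relations between the points w and w+1 make sense: the Pearson equation
    for rho_k and the condition on psi at w, the derivative of phi at w+1. *)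
Definition step_ok (X : lattice) (k : R) (phi1_ok psi_ok : C -> Prop) (w : C) : Prop :=
  Delta (xs X (k - 1)) w <> 0 /\ Delta (xs X k) w <> 0 /\ psi_ok w /\ phi1_ok (w + 1).

(** phi / rho_k solves the equation at every z such that all expressions
    involved in the equation at z are meaningful. *)
Definition is_solution (X : lattice) (co : coeffs) (nu mu : R) (lam : C) (rho_k : pfun)
    (phi : R -> C -> C) (phi_ok : R -> C -> Prop) (psi_ok : C -> Prop) : Prop :=
  forall z : C,
    y_ok rho_k (phi_ok mu) (z - 1) -> y_ok rho_k (phi_ok mu) z ->
    y_ok rho_k (phi_ok mu) (z + 1) ->
    step_ok X (nu - mu) (phi_ok (mu + 1)%R) psi_ok (z - 1) ->
    step_ok X (nu - mu) (phi_ok (mu + 1)%R) psi_ok z ->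
    hyper_eq X co (nu - mu) lam (fun w => 1 / rho_k w * phi mu w) z.

(* Main.v *)
Require Import Defs.
From Stdlib Require Import Lra Lia.

(** Write k = nu - mu, K = kappa (2 nu - mu) and
    theta_s(z) = rho_nu(s) nabla x_{nu+1}(s) / [x_nu(s) - x_nu(z)]^(mu+1)
    for the summand or integrand of phi = phi_{nu,mu}.

    The Pearson equation for rho_k turns the equation for y = phi / rho_k into
      Delta F[phi](z) + lambda Delta x_{k-1}(z) phi(z) = 0,
    where the flux F[phi] = sigma rho_k nabla y / nabla x_k no longer contains
    rho_k once it is written in terms of phi ([hyper_eq_of_flux]).  This relation
    is linear in phi, so it suffices to show that, with theta_s in place of phi,
    its left side is a combination of differences Delta_s psi whose sum or
    integral vanishes.

    That is a telescoping identity.  Put U_z(s) = x_nu(s) - x_nu(z + 1) and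
    V_z(s) = x_nu(s) - x_nu(z - mu), the factors that lead from the powers (mu+1)
    at z and at z + 1 to the power (mu+2) at z + 1.  Over that common denominator,
    Delta_s psi(s, z) is, up to rho_nu(s) nabla x_{nu+1}(s), a polynomial of
    degree at most 2 in x_nu(s), hence of the form K U V + alpha U + beta V; alpha and
    beta are found by evaluation at the roots of V and of U, and K is its
    coefficient of x_nu(s)^2 ([interpolation]).  The last two terms assemble into
    - F[theta_s](z + 1), so
      Delta_s psi(s, z) = K V_z(s) theta_s(z) - F[theta_s](z + 1)   ([Delta_psi]).
    Since V_z theta_s(z) = U_z theta_s(z + 1) ([phi_term_exchange]), subtracting
    this relation at z - 1 from that at z leaves the coefficient
    V_z - U_{z-1} = x_nu(z) - x_nu(z - mu) = gamma(mu) Delta x_{k-1}(z)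
    in front of K theta_s(z), and K gamma(mu) = - lambda by the choice of the
    roots nu, mu ([Delta_psi_difference]). *)

(** * The exponential and the values of the lattice *)

(** Decides identities that are linear in complex unknowns and that mix real
    arithmetic under [RtoC] with complex arithmetic. *)
Ltac Clin := apply injective_projections; simpl; field.

Lemma Cexp_plus (u v : C) : Cexp (u + v) = Cexp u * Cexp v.
Proof.
  destruct u as [u1 u2], v as [v1 v2].
  unfold Cexp; apply injective_projections; simpl;
    rewrite exp_plus, ?cos_plus, ?sin_plus; ring.
Qed.

Lemma qpow_plus (ell u v : C) : qpow ell (u + v) = qpow ell u * qpow ell v.
Proof. unfold qpow; rewrite <- Cexp_plus; f_equal; ring. Qed.

Lemma qpow_inv_l (ell u : C) : qpow ell (- u) * qpow ell u = 1.
Proof.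
  rewrite <- qpow_plus; unfold qpow.
  replace (ell * (- u + u)) with (RtoC 0) by ring.
  unfold Cexp; apply injective_projections; simpl; rewrite exp_0, ?cos_0, ?sin_0; ring.
Qed.

Lemma qpow_neq_0 (ell u : C) : qpow ell u <> 0.
Proof.
  intros H; pose proof (qpow_inv_l ell u) as E; rewrite H in E.
  apply C1_nz. rewrite <- E; ring.
Qed.

Lemma qpow_opp (ell u : C) : qpow ell (- u) = / qpow ell u.
Proof.
  pose proof (qpow_inv_l ell u) as E; pose proof (qpow_neq_0 ell u) as Hn.
  rewrite <- (Cmult_1_l (/ qpow ell u)), <- E; now field.
Qed.

Lemma qpow_half_sqr (q ell : C) (Hq : q <> 1) (He : Cexp ell = q) :
  qpow ell (RtoC (1 / 2)) * qpow ell (RtoC (1 / 2)) - 1 <> 0.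
Proof.
  rewrite <- qpow_plus; intros H; apply Hq.
  assert (E : qpow ell (RtoC (1 / 2) + RtoC (1 / 2)) = q).
  { unfold qpow; rewrite <- He; f_equal; Clin. }
  rewrite E in H; rewrite <- (Cplus_0_l 1), <- H; ring.
Qed.

Lemma qpow_minus (ell u v : C) : qpow ell (u - v) = qpow ell u / qpow ell v.
Proof. unfold Cminus; now rewrite qpow_plus, qpow_opp. Qed.

Lemma xlat_q (q ell c1 c2 c3 w : C) :
  xlat (QLattice q ell c1 c2 c3) w = c1 * qpow ell w + c2 / qpow ell w + c3.
Proof. simpl; now rewrite qpow_opp. Qed.

(** The steps of all shifted lattices x_eta are differences of x over an interval
    of length 1; naming them by the midpoint makes the shifts coincide. *)
Definition cdiff (X : lattice) (w : C) : C :=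
  xlat X (w + RtoC (1 / 2)) - xlat X (w - RtoC (1 / 2)).

(** By [sigma_plus_cdiff] and [sigma_cdiff], [sigma_plus] and [sigma] are exchanged
    by the reflection of the lattice that reverses the sign of [cdiff]. *)
Definition sigma_plus (X : lattice) (co : coeffs) (w : C) : C :=
  sigma X co w + tau X co w * nabla (xs X 1) w.

Lemma nabla_xs_1 (X : lattice) (w : C) : nabla (xs X 1) w = cdiff X w.
Proof. unfold nabla, xs, cdiff; f_equal; f_equal; Clin. Qed.

Lemma RtoC_half : RtoC (1 / 2) = 1 / 2.
Proof. Clin. Qed.

Lemma sigma_cdiff (X : lattice) (co : coeffs) (w : C) :
  sigma X co w = sigma_t co (xlat X w) - 1 / 2 * tau_t co (xlat X w) * cdiff X w.
Proof. unfold sigma; rewrite nabla_xs_1, RtoC_half; reflexivity. Qed.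

Lemma sigma_plus_cdiff (X : lattice) (co : coeffs) (w : C) :
  sigma_plus X co w = sigma_t co (xlat X w) + 1 / 2 * tau_t co (xlat X w) * cdiff X w.
Proof.
  unfold sigma_plus, tau; rewrite sigma_cdiff, nabla_xs_1; field.
Qed.

(** With p = s + nu/2, r = z + (k+1)/2, n = nu/2, h = (mu+1)/2, this expands the
    numerator of Delta_s psi(s, z) in the basis U V, U, V.  The left side is odd
    under the reflection of the lattice about p, so its quotient by [cdiff X p] is
    a polynomial in x(p), of degree at most 2: this is why such an expansion exists.  At
    the roots p = r + h and p = r - h of the two factors one of the terms on the
    left vanishes, which gives the coefficients; the division by [cdiff X r] they
    require is cleared.  The identity itself is one between rational functions of
    q^p, q^r, q^n, q^h, q^(1/2), or between polynomials for the quadratic lattice. *)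
Lemma interpolation (X : lattice) (HX : lattice_wf X) (co : coeffs) (p r : C) (n h : R) :
  (sigma_plus X co (p + n) * (xlat X (p - h) - xlat X r)
   - sigma X co (p - n) * (xlat X (p + h) - xlat X r)) * cdiff X r
  = cdiff X p *
    (kappa X co (4 * n - 2 * h + 1)
       * (xlat X p - xlat X (r + h)) * (xlat X p - xlat X (r - h)) * cdiff X r
     + sigma_plus X co (r - h + n) * (xlat X p - xlat X (r + h))
     - sigma X co (r + h - n) * (xlat X p - xlat X (r - h))).
Proof.
  rewrite !sigma_cdiff, !sigma_plus_cdiff; unfold cdiff, kappa, dtau_t, d2sigma_t, sigma_t, tau_t.
  destruct X as [q ell c1 c2 c3 | c1 c2 c3].
  - destruct HX as [_ [Hq [He _]]].
    pose proof (qpow_half_sqr q ell Hq He) as HD.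
    rewrite !xlat_q; unfold gam, alph.
    replace (RtoC ((4 * n - 2 * h + 1 - 1) / 2)) with (RtoC n + RtoC n - RtoC h) by Clin.
    replace (RtoC (- ((4 * n - 2 * h + 1 - 1) / 2)))
      with (RtoC h - (RtoC n + RtoC n)) by Clin.
    replace (RtoC (- (1 / 2))) with (- RtoC (1 / 2)) by Clin.
    rewrite ?qpow_minus, ?qpow_plus, ?qpow_minus, ?qpow_plus, ?qpow_minus, ?qpow_opp.
    pose proof (qpow_neq_0 ell p); pose proof (qpow_neq_0 ell r).
    pose proof (qpow_neq_0 ell n); pose proof (qpow_neq_0 ell h).
    pose proof (qpow_neq_0 ell (RtoC (1 / 2))).
    (* The 1 / 2 inside the exponent must not be rewritten with the coefficients. *)
    generalize dependent (qpow ell (RtoC (1 / 2))); intros D HD HD0.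
    rewrite RtoC_half. field. repeat split; assumption.
  - unfold gam, alph, xlat.
    replace (RtoC (4 * n - 2 * h + 1 - 1)) with (4 * RtoC n - 2 * RtoC h) by Clin.
    rewrite RtoC_half; field.
Qed.

(** The length eta of a step about w enters through one factor: on the q-lattice
    the left side is (q^(eta/2) - q^(-eta/2)) (c1 q^w - c2 q^(-w)). *)
Lemma xlat_diff_gam (X : lattice) (HX : lattice_wf X) (w : C) (eta : R) :
  xlat X (w + RtoC (eta / 2)) - xlat X (w - RtoC (eta / 2)) = gam X eta * cdiff X w.
Proof.
  unfold cdiff; destruct X as [q ell c1 c2 c3 | c1 c2 c3].
  - destruct HX as [_ [Hq [He _]]].
    pose proof (qpow_half_sqr q ell Hq He) as HD.
    rewrite !xlat_q; unfold gam.
    rewrite (RtoC_opp (eta / 2)), (RtoC_opp (1 / 2)), !qpow_minus, !qpow_plus, !qpow_opp.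
    pose proof (qpow_neq_0 ell (RtoC (1 / 2))).
    field; repeat split; try assumption; apply qpow_neq_0.
  - unfold gam, xlat.
    replace (RtoC (eta / 2)) with (RtoC eta / 2) by Clin.
    rewrite RtoC_half; field.
Qed.

(** * The Pearson equation and the flux form of the hypergeometric equation *)

Lemma Cdiv_eq_mult (u v w : C) : v <> 0 -> u / v = w -> u = w * v.
Proof. intros Hv <-; field; exact Hv. Qed.

Lemma taus_mult (X : lattice) (co : coeffs) (k : R) (w : C)
  (Hne : nabla (xs X (k + 1)) w <> 0) :
  taus X co k w * nabla (xs X (k + 1)) w = sigma_plus X co (w + k) - sigma X co w.
Proof. unfold taus, sigma_plus; field; exact Hne. Qed.

(** The denominator of [taus] is the step in the Pearson equation, so the
    equation carries sigma rho from w to w + 1 without any quotient. *)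
Lemma pearson_step (X : lattice) (co : coeffs) (k : R) (dx : C -> C) (rho : pfun)
  (Hrho : pearson X co dx (taus X co k) rho) (w : C)
  (Hdx : dx w = nabla (xs X (k + 1)) w) (Hne : dx w <> 0)
  (H0 : pdom rho w) (H1 : pdom rho (w + 1)) :
  sigma X co (w + 1) * rho (w + 1) = sigma_plus X co (w + k) * rho w.
Proof.
  pose proof (Hrho w H0 H1 Hne) as E.
  apply Cdiv_eq_mult in E; [| exact Hne].
  rewrite Hdx in E, Hne.
  pose proof (taus_mult X co k w Hne) as Ht.
  transitivity (Delta (fun w => sigma X co w * rho w) w + sigma X co w * rho w);
    [unfold Delta; ring |].
  rewrite E.
  transitivity (taus X co k w * nabla (xs X (k + 1)) w * rho w + sigma X co w * rho w);
    [ring | rewrite Ht; ring].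
Qed.

Lemma Delta_xs_nabla (X : lattice) (k : R) (w : C) :
  Delta (xs X (k - 1)) w = nabla (xs X (k + 1)) w.
Proof. unfold Delta, nabla, xs; f_equal; f_equal; Clin. Qed.

(** If rho_k solves the Pearson equation, this is
    sigma rho_k nabla (phi / rho_k) / nabla x_k, with sigma(w) rho_k(w) expressed by
    rho_k(w - 1). *)
Definition flux (X : lattice) (co : coeffs) (k : R) (phi : C -> C) (w : C) : C :=
  (sigma X co w * phi w - sigma_plus X co (w - 1 + k) * phi (w - 1)) / nabla (xs X k) w.

(** The self-adjoint form of the equation: multiplied by rho, the first two terms
    become a single difference quotient. *)
Lemma hyper_eq_of_flux (X : lattice) (co : coeffs) (k : R) (lam : C)
  (rho : pfun) (Hrho : pearson X co (Delta (xs X (k - 1))) (taus X co k) rho)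
  (phi : C -> C) (z : C)
  (Hdm : pdom rho (z - 1)) (Hd : pdom rho z) (Hdp : pdom rho (z + 1))
  (Hrm : rho (z - 1) <> 0) (Hr : rho z <> 0) (Hrp : rho (z + 1) <> 0)
  (Hxm : Delta (xs X (k - 1)) (z - 1) <> 0) (Hx : Delta (xs X (k - 1)) z <> 0)
  (Hym : Delta (xs X k) (z - 1) <> 0) (Hy : Delta (xs X k) z <> 0)
  (Hflux : Delta (flux X co k phi) z + lam * Delta (xs X (k - 1)) z * phi z = 0) :
  hyper_eq X co k lam (fun w => 1 / rho w * phi w) z.
Proof.
  assert (Ez : z - 1 + 1 = z) by ring.
  assert (Ez' : z + 1 - 1 = z) by ring.
  pose proof (pearson_step X co k _ rho Hrho z (Delta_xs_nabla X k z) Hx Hd Hdp) as Pz.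
  pose proof (pearson_step X co k _ rho Hrho (z - 1) (Delta_xs_nabla X k (z - 1)) Hxm Hdm)
    as Pm.
  rewrite Ez in Pm; specialize (Pm Hd).
  assert (Sp : sigma_plus X co (z + k) = sigma X co (z + 1) * rho (z + 1) / rho z)
    by (rewrite Pz; field; exact Hr).
  assert (Sm : sigma_plus X co (z - 1 + k) = sigma X co z * rho z / rho (z - 1))
    by (rewrite Pm; field; exact Hrm).
  assert (T : taus X co k z
              = (sigma_plus X co (z + k) - sigma X co z) / Delta (xs X (k - 1)) z)
    by (rewrite Delta_xs_nabla in Hx |- *; rewrite <- taus_mult by exact Hx;
        field; exact Hx).
  rewrite Sp in T.
  unfold hyper_eq.
  transitivity ((Delta (flux X co k phi) z + lam * Delta (xs X (k - 1)) z * phi z)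
                / (Delta (xs X (k - 1)) z * rho z)).
  2: { rewrite Hflux; field; split; assumption. }
  rewrite T.
  set (A := Delta (xs X (k - 1)) z) in *.
  unfold flux, Delta at 1 2 4, nabla; cbv beta; rewrite !Ez', Sp, Sm.
  change (xs X k (z + 1) - xs X k z) with (Delta (xs X k) z).
  replace (xs X k z - xs X k (z - 1)) with (Delta (xs X k) (z - 1))
    by (unfold Delta; now rewrite Ez).
  set (B := Delta (xs X k) z) in *.
  set (B' := Delta (xs X k) (z - 1)) in *.
  field; repeat split; assumption.
Qed.

(** * The difference of psi *)

(** Passage to a common denominator G, a multiple g * a of the given one. *)
Lemma Cdiv_factor (u g a G : C) : g <> 0 -> G <> 0 -> g * a = G -> u / g = u * a / G.
Proof.
  intros Hg HG <-.
  assert (a <> 0) by (intros ->; apply HG; ring).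
  field; split; assumption.
Qed.

(** Formally both sides are the summand of phi_{nu,mu-1}(z), reduced by the two
    forms of the recursion for generalized powers.  Written with powers of order
    mu + 1, the identity also covers points at which the power of order mu has a
    pole. *)
Lemma phi_term_exchange (X : lattice) (P : gen_power X) (nu mu : R) (rho_nu : pfun)
  (s z : C)
  (H0 : phi_term_ok X P rho_nu nu mu z s) (H1 : phi_term_ok X P rho_nu nu mu (z + 1) s)
  (H2 : phi_term_ok X P rho_nu nu (mu + 1) (z + 1) s) :
  (xs X nu s - xs X nu (z - mu)) * phi_term X P rho_nu nu mu z s
  = (xs X nu s - xs X nu (z + 1)) * phi_term X P rho_nu nu mu (z + 1) s.
Proof.
  destruct H0 as [_ [D0 N0]], H1 as [_ [D1 N1]], H2 as [_ [D2 N2]].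
  assert (Ez : z + 1 - 1 = z) by ring.
  destruct (gp_rec X P nu (mu + 1) s (z + 1)) as [R1 R2]; rewrite ?Ez; try assumption.
  rewrite Ez in R1.
  replace (z + 1 - (mu + 1)%R) with (z - mu) in R1, R2 by Clin.
  unfold phi_term.
  rewrite (Cdiv_factor _ _ (xs X nu s - xs X nu (z + 1)) _ N0 N2)
    by (rewrite <- R2, <- R1; ring).
  rewrite (Cdiv_factor _ _ _ _ N1 N2 R2); unfold Cdiv; ring.
Qed.

(** The shift relations put psi(s + 1, z) and psi(s, z) over the power of order
    mu + 2 at z + 1, and the Pearson equation for rho_nu expresses the numerator by
    rho_nu(s) alone; what remains is the left side of [interpolation]. *)
Lemma Delta_psi
  (X : lattice) (HX : lattice_wf X) (co : coeffs) (P : gen_power X)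
  (nu mu : R) (rho_nu : pfun)
  (Hrho_nu : pearson X co (nabla (xs X (nu + 1))) (taus X co nu) rho_nu)
  (s : C) (Hs : nabla (xs X (nu + 1)) s <> 0)
  (z : C) (Hz : Delta (xs X (nu - mu)) z <> 0)
  (Hpsi : psi_ok X P rho_nu nu mu s z) (Hpsi1 : psi_ok X P rho_nu nu mu (s + 1) z)
  (H0 : phi_term_ok X P rho_nu nu mu z s) (H1 : phi_term_ok X P rho_nu nu mu (z + 1) s)
  (H2 : phi_term_ok X P rho_nu nu (mu + 1) (z + 1) s) :
  Delta (fun t => psi X co P rho_nu nu mu t z) s
  = kappa X co (2 * nu - mu) * ((xs X nu s - xs X nu (z - mu)) * phi_term X P rho_nu nu mu z s)
    - flux X co (nu - mu) (fun w => phi_term X P rho_nu nu mu w s) (z + 1).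
Proof.
  destruct H0 as [_ [D0 N0]], H1 as [_ [D1 N1]], H2 as [_ [D2 N2]].
  destruct Hpsi as [Ds [DS NS]], Hpsi1 as [Ds1 [DS1 NS1]].
  assert (Ez : z + 1 - 1 = z) by ring.
  destruct (gp_rec X P nu (mu + 1) s (z + 1)) as [R1 R2]; rewrite ?Ez; try assumption.
  destruct (gp_shift X P nu (mu + 1) s (z + 1)) as [S1 S2]; try assumption.
  rewrite Ez in R1; rewrite R2 in R1; rewrite S2 in S1.
  pose proof (pearson_step X co nu _ rho_nu Hrho_nu s eq_refl Hs Ds Ds1) as E'.
  set (p := s + RtoC (nu / 2)).
  set (r := z + RtoC ((nu - mu + 1) / 2)).
  pose proof (interpolation X HX co p r (nu / 2) ((mu + 1) / 2)) as I.
  assert (Ep : nabla (xs X (nu + 1)) s = cdiff X p)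
    by (unfold nabla, xs, cdiff, p; f_equal; f_equal; Clin).
  assert (Er : Delta (xs X (nu - mu)) z = cdiff X r)
    by (unfold Delta, xs, cdiff, r; f_equal; f_equal; Clin).
  assert (Ekap : (4 * (nu / 2) - 2 * ((mu + 1) / 2) + 1 = 2 * nu - mu)%R) by field.
  rewrite Ekap in I.
  replace (p + RtoC (nu / 2)) with (s + nu) in I by (unfold p; Clin).
  replace (p - RtoC (nu / 2)) with s in I by (unfold p; Clin).
  replace (r - RtoC ((mu + 1) / 2) + RtoC (nu / 2)) with (z + RtoC (nu - mu)) in I
    by (unfold r; Clin).
  replace (r + RtoC ((mu + 1) / 2) - RtoC (nu / 2)) with (z + 1) in I by (unfold r; Clin).
  replace (xlat X (p - RtoC ((mu + 1) / 2))) with (xs X (nu - (mu + 1)) s) in I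
    by (unfold xs, p; f_equal; Clin).
  replace (xlat X (p + RtoC ((mu + 1) / 2))) with (xs X (nu - (mu + 1)) (s + (mu + 1)%R)) in I
    by (unfold xs, p; f_equal; Clin).
  replace (xlat X r) with (xs X (nu - (mu + 1)) (z + 1)) in I
    by (unfold xs, r; f_equal; Clin).
  replace (xlat X (r + RtoC ((mu + 1) / 2))) with (xs X nu (z + 1)) in I
    by (unfold xs, r; f_equal; Clin).
  replace (xlat X (r - RtoC ((mu + 1) / 2))) with (xs X nu (z - mu)) in I
    by (unfold xs, r; f_equal; Clin).
  replace (xlat X p) with (xs X nu s) in I by reflexivity.
  replace (z + 1 - (mu + 1)%R) with (z - mu) in R2 by Clin.
  rewrite <- Ep, <- Er in I.
  unfold flux, phi_term, Delta at 1, psi.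
  replace (nabla (xs X (nu - mu)) (z + 1)) with (Delta (xs X (nu - mu)) z)
    by (unfold nabla, Delta; now rewrite Ez).
  rewrite !Ez, E'.
  rewrite (Cdiv_factor _ _ (xs X nu s - xs X nu (z + 1)) _ N0 N2)
    by (rewrite <- R1; ring).
  rewrite (Cdiv_factor _ _ _ _ N1 N2 R2), (Cdiv_factor _ _ _ _ NS1 N2 S1).
  rewrite (Cdiv_factor _ _ (xs X (nu - (mu + 1)) (s + (mu + 1)%R) - xs X (nu - (mu + 1)) (z + 1)) _ NS N2)
    by (rewrite <- S2; ring).
  clear - I Hz N2.
  match type of I with ?l = _ =>
    transitivity (l * rho_nu s
      / (P nu (mu + 1 + 1)%R s (z + 1) * Delta (xs X (nu - mu)) z))
  end.
  - field; split; assumption.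
  - rewrite I; field; split; assumption.
Qed.

(** After [phi_term_exchange] at z - 1, the K-terms of [Delta_psi] at z and at z - 1
    are both multiples of theta_s(z), and the difference of their factors is free
    of s; hence the left side can be summed over s. *)
Lemma Delta_psi_difference
  (X : lattice) (HX : lattice_wf X) (co : coeffs) (P : gen_power X)
  (nu mu : R) (rho_nu : pfun)
  (Hrho_nu : pearson X co (nabla (xs X (nu + 1))) (taus X co nu) rho_nu)
  (s : C) (Hs : nabla (xs X (nu + 1)) s <> 0)
  (lam : C)
  (Hroots : lam + kappa X co (2 * nu - mu) * gam X mu = 0) (z : C)
  (Hzm : Delta (xs X (nu - mu)) (z - 1) <> 0) (Hz : Delta (xs X (nu - mu)) z <> 0)
  (Hpm : psi_ok X P rho_nu nu mu s (z - 1)) (Hpm1 : psi_ok X P rho_nu nu mu (s + 1) (z - 1))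
  (Hp : psi_ok X P rho_nu nu mu s z) (Hp1 : psi_ok X P rho_nu nu mu (s + 1) z)
  (Hm : phi_term_ok X P rho_nu nu mu (z - 1) s) (H0 : phi_term_ok X P rho_nu nu mu z s)
  (H1 : phi_term_ok X P rho_nu nu mu (z + 1) s)
  (Hn : phi_term_ok X P rho_nu nu (mu + 1) z s)
  (Hn1 : phi_term_ok X P rho_nu nu (mu + 1) (z + 1) s) :
  Delta (flux X co (nu - mu) (fun w => phi_term X P rho_nu nu mu w s)) z
    + lam * Delta (xs X (nu - mu - 1)) z * phi_term X P rho_nu nu mu z s
  = Delta (fun t => psi X co P rho_nu nu mu t (z - 1)) s
    - Delta (fun t => psi X co P rho_nu nu mu t z) s.
Proof.
  assert (Ez : z - 1 + 1 = z) by ring.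
  rewrite (Delta_psi X HX co P nu mu rho_nu Hrho_nu s Hs z) by assumption.
  rewrite (Delta_psi X HX co P nu mu rho_nu Hrho_nu s Hs (z - 1))
    by (rewrite ?Ez; assumption).
  rewrite (phi_term_exchange X P nu mu rho_nu s (z - 1)) by (rewrite ?Ez; assumption).
  rewrite Ez.
  set (theta := fun w => phi_term X P rho_nu nu mu w s).
  change (phi_term X P rho_nu nu mu z s) with (theta z).
  assert (G : xs X nu z - xs X nu (z - mu) = gam X mu * Delta (xs X (nu - mu - 1)) z).
  { replace (Delta (xs X (nu - mu - 1)) z) with (cdiff X (z + RtoC ((nu - mu) / 2)))
      by (unfold Delta, xs, cdiff; f_equal; f_equal; Clin).
    rewrite <- (xlat_diff_gam X HX); unfold xs; f_equal; f_equal; Clin. }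
  assert (L : lam = - (kappa X co (2 * nu - mu) * gam X mu))
    by (rewrite <- (Cplus_0_l (- _)), <- Hroots; ring).
  unfold Delta at 1; rewrite L.
  transitivity (flux X co (nu - mu) theta (z + 1) - flux X co (nu - mu) theta z
    - kappa X co (2 * nu - mu) * (gam X mu * Delta (xs X (nu - mu - 1)) z) * theta z);
    [ring | rewrite <- G; ring].
Qed.

(** * Summation and integration of the identity *)

(** A sum or an integral, given by its graph because the integral is partial;
    [S] is the set of points at which its argument is sampled. *)
Record linear_functional (S : C -> Prop) (I : (C -> C) -> C -> Prop) : Prop := {
  lf_ext : forall f g l, (forall s, S s -> f s = g s) -> I f l -> I g l;
  lf_lin : forall u v f g l m,
    I f l -> I g m -> I (fun s => u * f s + v * g s) (u * l + v * m);
  lf_unique : forall f l m, I f l -> I f m -> l = m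
}.

(** The coefficients of the flux are independent of s. *)
Lemma lf_flux (S : C -> Prop) (I : (C -> C) -> C -> Prop) (HI : linear_functional S I)
  (X : lattice) (co : coeffs) (k : R) (theta : C -> C -> C) (phi : C -> C) (w : C)
  (H0 : I (theta w) (phi w)) (H1 : I (theta (w - 1)) (phi (w - 1))) :
  I (fun s => flux X co k (fun v => theta v s) w) (flux X co k phi w).
Proof.
  pose proof (lf_lin _ _ HI (sigma X co w / nabla (xs X k) w)
    (- sigma_plus X co (w - 1 + k) / nabla (xs X k) w) _ _ _ _ H0 H1) as H.
  replace (flux X co k phi w) with
    (sigma X co w / nabla (xs X k) w * phi w
     + - sigma_plus X co (w - 1 + k) / nabla (xs X k) w * phi (w - 1))
    by (unfold flux, Cdiv; ring).
  revert H; apply (lf_ext _ _ HI); intros s _; unfold flux, Cdiv; ring.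
Qed.

(** Common part of the two claims: the flux equation for phi is the image under
    the functional of the one for the summand, where the differences of psi in s
    contribute 0. *)
Lemma is_solution_lf (S : C -> Prop) (I : (C -> C) -> C -> Prop)
  (HI : linear_functional S I)
  (X : lattice) (HX : lattice_wf X) (co : coeffs) (P : gen_power X)
  (nu mu : R) (lam : C) (rho_nu rho_k : pfun)
  (Hrho_nu : pearson X co (nabla (xs X (nu + 1))) (taus X co nu) rho_nu)
  (Hrho_k : pearson X co (Delta (xs X (nu - mu - 1))) (taus X co (nu - mu)) rho_k)
  (Hroots : lam + kappa X co (2 * nu - mu) * gam X mu = 0)
  (HS : forall s, S s -> nabla (xs X (nu + 1)) s <> 0)
  (phi : R -> C -> C) (phi_ok : R -> C -> Prop) (psi_ok' : C -> Prop)
  (Hphi_ok : forall m z s, phi_ok m z -> S s -> phi_term_ok X P rho_nu nu m z s)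
  (Hphi : forall m z, phi_ok m z -> I (phi_term X P rho_nu nu m z) (phi m z))
  (Hpsi_ok : forall z s, psi_ok' z -> S s ->
     psi_ok X P rho_nu nu mu s z /\ psi_ok X P rho_nu nu mu (s + 1) z)
  (Hpsi : forall z, psi_ok' z -> I (Delta (fun s => psi X co P rho_nu nu mu s z)) 0) :
  is_solution X co nu mu lam rho_k phi phi_ok psi_ok'.
Proof.
  intros z [Dm [Nm Om]] [D0 [N0 O0]] [D1 [N1 O1]] [Xm [Ym [Pm Fm]]] [X0 [Y0 [P0 F0]]].
  assert (Ez : z - 1 + 1 = z) by ring.
  assert (Ez' : z + 1 - 1 = z) by ring.
  rewrite Ez in Fm.
  apply hyper_eq_of_flux; try assumption.
  pose proof (lf_flux S I HI X co (nu - mu) (phi_term X P rho_nu nu mu) (phi mu) z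
                (Hphi _ _ O0) (Hphi _ _ Om)) as L0.
  assert (L1 := lf_flux S I HI X co (nu - mu) (phi_term X P rho_nu nu mu) (phi mu) (z + 1)
                (Hphi _ _ O1)).
  rewrite Ez' in L1; specialize (L1 (Hphi _ _ O0)).
  pose proof (lf_lin _ _ HI 1 (- (1)) _ _ _ _ L1 L0) as L2.
  pose proof (lf_lin _ _ HI 1 (lam * Delta (xs X (nu - mu - 1)) z) _ _ _ _ L2 (Hphi _ _ O0)) as L.
  pose proof (lf_lin _ _ HI 1 (- (1)) _ _ _ _ (Hpsi _ Pm) (Hpsi _ P0)) as K.
  apply (lf_ext _ _ HI _ (fun s =>
    1 * Delta (fun t => psi X co P rho_nu nu mu t (z - 1)) s
    + - (1) * Delta (fun t => psi X co P rho_nu nu mu t z) s)) in L.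
  - pose proof (lf_unique _ _ HI _ _ _ L K) as E.
    unfold Delta at 1.
    transitivity (1 * (1 * flux X co (nu - mu) (phi mu) (z + 1)
                       + - (1) * flux X co (nu - mu) (phi mu) z)
                  + lam * Delta (xs X (nu - mu - 1)) z * phi mu z);
      [ring | rewrite E; ring].
  - intros s Hs.
    pose proof (Delta_psi_difference X HX co P nu mu rho_nu Hrho_nu s (HS s Hs)
      lam Hroots z Ym Y0 (proj1 (Hpsi_ok _ _ Pm Hs)) (proj2 (Hpsi_ok _ _ Pm Hs))
      (proj1 (Hpsi_ok _ _ P0 Hs)) (proj2 (Hpsi_ok _ _ P0 Hs))
      (Hphi_ok _ _ _ Om Hs) (Hphi_ok _ _ _ O0 Hs) (Hphi_ok _ _ _ O1 Hs)
      (Hphi_ok _ _ _ Fm Hs) (Hphi_ok _ _ _ F0 Hs)) as E.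
    rewrite !Cmult_1_l.
    transitivity (Delta (fun t => psi X co P rho_nu nu mu t (z - 1)) s
      - Delta (fun t => psi X co P rho_nu nu mu t z) s); [rewrite <- E | ring].
    unfold Delta at 2; ring.
Qed.

Lemma csum_S (f : C -> C) (a : C) (N : nat) :
  csum f a (S N) = csum f a N + f (a + RtoC (INR N)).
Proof.
  unfold csum; rewrite seq_S, map_app, fold_right_app; simpl fold_right.
  generalize (f (a + RtoC (INR (0 + N)))); intros e.
  induction (map (fun j : nat => f (a + RtoC (INR j))) (seq 0 N)) as [| y l IH];
    simpl; [ring | rewrite IH; ring].
Qed.

Lemma csum_Delta (f : C -> C) (a : C) (N : nat) :
  csum (Delta f) a N = f (a + RtoC (INR N)) - f a.
Proof.
  induction N as [| N IH].
  - unfold csum; simpl. replace (a + 0) with a by ring. ring.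
  - rewrite csum_S, IH, S_INR, RtoC_plus; unfold Delta.
    replace (a + (RtoC (INR N) + 1)) with (a + RtoC (INR N) + 1) by ring; ring.
Qed.

Lemma csum_linear_functional (a : C) (N : nat) :
  linear_functional (fun s => exists j, (j < N)%nat /\ s = a + RtoC (INR j))
    (fun f l => csum f a N = l).
Proof.
  split.
  - intros f g l H <-; unfold csum; f_equal; apply map_ext_in.
    intros j Hj; apply in_seq in Hj; symmetry; apply H.
    exists j; split; [apply Hj | reflexivity].
  - intros u v f g l m <- <-; clear.
    induction N as [| N IH]; [unfold csum; simpl; ring |].
    rewrite !csum_S, IH; ring.
  - intros f l m <- <-; reflexivity.
Qed.

(** The integral is linear over the reals by construction; multiplication by a
    complex number mixes the real and imaginary parts. *)
Lemma is_cint_scal (f : C -> C) (c : contour) (u l : C) :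
  is_cint f c l -> is_cint (fun s => u * f s) c (u * l).
Proof.
  unfold is_cint; intros H.
  pose proof (is_RInt_fct_extend_fst (U:=R_NormedModule) (V:=R_NormedModule) _ _ _ _ H) as H1.
  pose proof (is_RInt_fct_extend_snd (U:=R_NormedModule) (V:=R_NormedModule) _ _ _ _ H) as H2.
  apply (is_RInt_fct_extend_pair (U:=R_NormedModule) (V:=R_NormedModule)).
  - eapply is_RInt_ext.
    2: exact (is_RInt_minus _ _ _ _ _ _ (is_RInt_scal _ _ _ (fst u) _ H1)
                                        (is_RInt_scal _ _ _ (snd u) _ H2)).
    intros t _; simpl; unfold minus, plus, opp, scal; simpl; unfold mult; simpl; ring.
  - eapply is_RInt_ext.
    2: exact (is_RInt_plus _ _ _ _ _ _ (is_RInt_scal _ _ _ (fst u) _ H2)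
                                       (is_RInt_scal _ _ _ (snd u) _ H1)).
    intros t _; simpl; unfold plus, scal; simpl; unfold mult; simpl; ring.
Qed.

Lemma cint_linear_functional (c : contour) :
  linear_functional (fun s => exists t, (0 <= t <= 1)%R /\ s = c t)
    (fun f l => is_cint f c l).
Proof.
  split.
  - intros f g l H; apply is_RInt_ext; intros t Ht.
    rewrite Rmin_left, Rmax_right in Ht by lra.
    rewrite (H (c t)); [reflexivity | exists t; split; [lra | reflexivity]].
  - intros u v f g l m Hf Hg.
    eapply is_RInt_ext.
    2: exact (is_RInt_plus _ _ _ _ _ _ (is_cint_scal _ _ u _ Hf) (is_cint_scal _ _ v _ Hg)).
    intros t _; symmetry; apply Cmult_plus_distr_r.
  - intros f l m Hl Hm.
    rewrite <- (is_RInt_unique (V := C_R_CompleteNormedModule) _ _ _ _ Hl).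
    exact (is_RInt_unique (V := C_R_CompleteNormedModule) _ _ _ _ Hm).
Qed.

Theorem corollary5p1
  (X : lattice) (HX : lattice_wf X)
  (co : coeffs) (P : gen_power X)
  (nu mu : R) (lam lam_star : C)
  (Hlam_star : lam_star = lam - kappa X co (2 * nu - 2 * mu - 1))
  (a b : C) (N : nat) (Him : Im a = Im b) (HN : b - a = RtoC (INR N))
  (c : contour)
  (rho rho_nu rho_k : pfun)
  (* (i) *)
  (Hrho : pearson X co (nabla (xs X 1)) (tau X co) rho)
  (Hrho_nu : pearson X co (nabla (xs X (nu + 1))) (taus X co nu) rho_nu)
  (* (ii) *)
  (Hstar : lam_star + kappa X co (2 * nu - (mu + 1)) * gam X (mu + 1) = 0)
  (Hrho_k : pearson X co (Delta (xs X (nu - mu - 1))) (taus X co (nu - mu)) rho_k)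
  (Hroots : lam + kappa X co (2 * nu - mu) * gam X mu = 0) :
  (* sums *)
  ((forall j : nat, (j < N)%nat -> nabla (xs X (nu + 1)) (a + RtoC (INR j)) <> 0) ->
   phi_derivative X nu mu
     (phi_sum X P rho_nu a N nu) (phi_sum_ok X P rho_nu a N nu) ->
   (forall z : C, psi_sum_ok X P rho_nu a N nu mu z ->
      psi X co P rho_nu nu mu a z = psi X co P rho_nu nu mu b z) ->
   is_solution X co nu mu lam rho_k
     (phi_sum X P rho_nu a N nu) (phi_sum_ok X P rho_nu a N nu)
     (psi_sum_ok X P rho_nu a N nu mu))
  /\
  (* contour integrals *)
  ((forall t : R, (0 <= t <= 1)%R -> nabla (xs X (nu + 1)) (c t) <> 0) ->
   phi_derivative X nu mu
     (phi_int X P rho_nu c nu) (phi_int_ok X P rho_nu c nu) ->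
   (forall z : C, psi_int_ok X P rho_nu c nu mu z ->
      is_cint (Delta (fun s => psi X co P rho_nu nu mu s z)) c 0) ->
   is_solution X co nu mu lam rho_k
     (phi_int X P rho_nu c nu) (phi_int_ok X P rho_nu c nu)
     (psi_int_ok X P rho_nu c nu mu)).
Proof.
  split.
  - intros HS _ Hpsi.
    apply (is_solution_lf _ _ (csum_linear_functional a N) X HX co P nu mu lam rho_nu rho_k
             Hrho_nu Hrho_k Hroots).
    + intros s [j [Hj ->]]; exact (HS j Hj).
    + intros m z s Hok [j [Hj ->]]; exact (Hok j Hj).
    + reflexivity.
    + intros z s Hok [j [Hj ->]]; split; [apply Hok; lia |].
      replace (a + RtoC (INR j) + 1) with (a + RtoC (INR (S j)))
        by (rewrite S_INR, RtoC_plus; ring).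
      apply Hok; lia.
    + intros z Hok.
      rewrite csum_Delta, <- HN.
      replace (a + (b - a)) with b by ring.
      rewrite (Hpsi z Hok); ring.
  - intros HS _ Hpsi.
    apply (is_solution_lf _ _ (cint_linear_functional c) X HX co P nu mu lam rho_nu rho_k
             Hrho_nu Hrho_k Hroots).
    + intros s [t [Ht ->]]; exact (HS t Ht).
    + intros m z s [Hok _] [t [Ht ->]]; exact (Hok t Ht).
    + intros m z [_ Hex]; exact (RInt_correct (V := C_R_CompleteNormedModule) _ _ _ Hex).
    + intros z s Hok [t [Ht ->]]; exact (Hok t Ht).
    + exact Hpsi.
Qed.
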